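(* Let $p$ be a prime, $q\ge 2$ an integer, $J\in\mathbb Q_p$ with $|J|_p<p^{-1/(p-1)}$, and $\theta=\exp_p(J)$. Then for any solution $z=(z_1,\dots,z_{q-1})\in\mathbb Q_p^{q-1}$ of the system of equations $$z_i=\left(\frac{(\theta-1)z_i+\sum_{j=1}^{q-1}z_j+1}{\theta+\sum_{j=1}^{q-1}z_j}\right)^2,\qquad i=1,\dots,q-1,$$ there exist a subset $M\subset\{1,\dots,q-1\}$ and $z^*\in\mathbb Q_p$ such that $z_i=1$ if $i\notin M$ and $z_i=z^*$ if $i\in M$.
   Context: $\mathbb Q_p$ is the field of $p$-adic numbers with norm $|\cdot|_p$, and $\exp_p(x)=\sum_{n\ge0}x^n/n!$, which converges for $|x|_p<p^{-1/(p-1)}$. A solution of the system is understood to have nonzero denominator $\theta+\sum_j z_j$. (This system is the fixed-point system for translation-invariant $p$-adic Gibbs measures of the $q$-state Potts model with coupling $J$ on the Cayley tree of order $k=2$.) *)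

(* Defs.v *)
From HB Require Import structures.
From mathcomp Require Import all_boot all_order all_algebra.
From mathcomp Require Import generic_quotient ring_quotient.
From mathcomp Require Import all_classical all_reals all_analysis.
From mathcomp Require Import ring lra zify.

Set Implicit Arguments.
Unset Strict Implicit.
Unset Printing Implicit Defensive.

Import Order.TTheory GRing.Theory Num.Theory numFieldNormedType.Exports.

Local Open Scope quotient_scope.
Local Open Scope classical_set_scope.
Local Open Scope ring_scope.

(* |x|_p = p ^ (- v_p x) *)
Definition padic_abs (R : realType) (p : nat) (x : rat) : R :=
  if x == 0 then 0
  else p%:R ^ ((logn p `|denq x|)%:Z - (logn p `|numq x|)%:Z).

Section PadicAbs.
Variables (R : realType) (p : nat) (pr : prime p).
Local Notation absp := (@padic_abs R p).

Lemma p_gt0 : 0 < p%:R :> R.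
Proof. by rewrite ltr0n prime_gt0. Qed.

Lemma p_ge1 : 1 <= p%:R :> R.
Proof. by rewrite ler1n prime_gt0. Qed.

Lemma padic_abs0 : absp 0 = 0.
Proof. by rewrite /padic_abs eqxx. Qed.

Lemma padic_abs_gt0 x : (0 < absp x) = (x != 0).
Proof.
rewrite /padic_abs; case: eqP => _ /=; first by rewrite ltxx.
by rewrite exprz_gt0 // p_gt0.
Qed.

Lemma padic_abs_ge0 x : 0 <= absp x.
Proof.
have [->|x0] := eqVneq x 0; first by rewrite padic_abs0.
by rewrite ltW // padic_abs_gt0.
Qed.

Lemma padic_abs_eq0 x : (absp x == 0) = (x == 0).
Proof. by apply: negb_inj; rewrite -padic_abs_gt0 lt0r padic_abs_ge0 andbT. Qed.

Lemma padic_absE (n d : int) : n != 0 -> d != 0 ->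
  absp (n%:Q / d%:Q) = p%:R ^ ((logn p `|d|)%:Z - (logn p `|n|)%:Z).
Proof.
move=> n0 d0; have nQ0 : n%:Q != 0 by rewrite intr_eq0.
have dQ0 : d%:Q != 0 by rewrite intr_eq0.
have x0 : n%:Q / d%:Q != 0 by rewrite mulf_neq0 ?invr_eq0.
rewrite /padic_abs (negPf x0); congr (_ ^ _).
set x := n%:Q / d%:Q.
have e : numq x * d = n * denq x.
  apply/eqP; rewrite -(eqr_int rat) !rmorphM /=.
  have dx : (denq x)%:~R != 0 :> rat by rewrite intr_eq0 denq_neq0.
  rewrite -(divfK dx (numq x)%:~R) divq_num_den {1}/x.
  by apply/eqP; field.
have := congr1 (fun z : int => logn p `|z|) e.
rewrite !abszM !lognM ?absz_gt0 ?numq_eq0 ?denq_neq0 // => e'.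
lia.
Qed.

Lemma padic_abs1 : absp 1 = 1.
Proof. by rewrite -[1 in LHS](@divr1 rat) (@padic_absE 1 1) // subrr expr0z. Qed.

Lemma padic_abs_prime : absp p%:R = p%:R^-1.
Proof.
have p0 : p%:Z != 0 by have := prime_gt0 pr; lia.
rewrite -[p%:R in LHS](@divr1 rat) (@padic_absE p 1) //= logn1.
by rewrite (pfactorK 1) // sub0r.
Qed.

Lemma padic_absM x y : absp (x * y) = absp x * absp y.
Proof.
have [->|x0] := eqVneq x 0; first by rewrite mul0r padic_abs0 mul0r.
have [->|y0] := eqVneq y 0; first by rewrite mulr0 padic_abs0 mulr0.
have nx0 : numq x != 0 by rewrite numq_eq0.
have ny0 : numq y != 0 by rewrite numq_eq0.
rewrite -[in LHS](divq_num_den x) -[in LHS](divq_num_den y) mulf_div -!intrM.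
rewrite padic_absE ?mulf_neq0 ?denq_neq0 // /padic_abs (negPf x0) (negPf y0).
rewrite -expfzDr ?gt_eqF ?p_gt0 //; congr (_ ^ _).
rewrite !abszM !lognM ?absz_gt0 ?denq_neq0 //; lia.
Qed.

Lemma padic_absV x : absp x^-1 = (absp x)^-1.
Proof.
have [->|x0] := eqVneq x 0; first by rewrite invr0 padic_abs0 invr0.
apply: (@mulIf _ (absp x)); first by rewrite padic_abs_eq0.
by rewrite -padic_absM !mulVf ?padic_abs1 // padic_abs_eq0.
Qed.

Lemma padic_absN x : absp (- x) = absp x.
Proof.
suff e : absp (- 1) = 1 by rewrite -mulN1r padic_absM e mul1r.
by rewrite -[- 1 in LHS](@divr1 rat) (@padic_absE (- 1) 1) // abszN subrr expr0z.
Qed.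

Lemma padic_abs_distC x y : absp (x - y) = absp (y - x).
Proof. by rewrite -padic_absN opprB. Qed.

Lemma padic_absD x y : absp (x + y) <= Num.max (absp x) (absp y).
Proof.
have [->|x0] := eqVneq x 0; first by rewrite add0r le_max lexx orbT.
have [->|y0] := eqVneq y 0; first by rewrite addr0 le_max lexx.
have [->|s0] := eqVneq (x + y) 0; first by rewrite padic_abs0 le_max padic_abs_ge0.
pose a := numq x * denq y; pose b := numq y * denq x; pose d := denq x * denq y.
have dx : (denq x)%:~R != 0 :> rat by rewrite intr_eq0 denq_neq0.
have dy : (denq y)%:~R != 0 :> rat by rewrite intr_eq0 denq_neq0.
have d0 : d != 0 by rewrite mulf_neq0 ?denq_neq0.
have ex : x = a%:Q / d%:Q.
  by rewrite -[LHS]divq_num_den /a /d !intrM; field; rewrite dx dy.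
have ey : y = b%:Q / d%:Q.
  by rewrite -[LHS]divq_num_den /b /d !intrM; field; rewrite dx dy.
have es : x + y = (a + b)%:Q / d%:Q by rewrite intrD mulrDl -ex -ey.
have ab0 : a + b != 0.
  by apply: contra_neq s0 => h; rewrite es h mul0r.
have a0 : a != 0 by apply: contra_neq x0 => h; rewrite ex h mul0r.
have b0 : b != 0 by apply: contra_neq y0 => h; rewrite ey h mul0r.
rewrite es [in X in Num.max X _]ex [in X in Num.max _ X]ey !padic_absE //.
rewrite le_max; set m := minn (logn p `|a|) (logn p `|b|).
have pm : (m <= logn p `|(a + b)%R|)%N.
  rewrite -pfactor_dvdn ?absz_gt0 //.
  have : ((p ^ m)%N %| a + b)%Z.
    apply: rpredD; rewrite dvdzE /= pfactor_dvdn ?absz_gt0 //; rewrite /m; lia.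
  by rewrite dvdzE.
have [ab|ba] := leqP (logn p `|a|) (logn p `|b|); apply/orP; [left|right];
  rewrite ler_weXz2l ?p_ge1 //; lia.
Qed.

Lemma padic_abs_eq x y : absp (y - x) < absp x -> absp y = absp x.
Proof.
move=> h; apply/eqP; rewrite eq_le; apply/andP; split.
  rewrite -[y in X in X <= _](subrK x); apply: le_trans (padic_absD _ _) _.
  by rewrite ge_max (ltW h) lexx.
have := padic_absD y (x - y); rewrite addrC subrK le_max => /orP[//|].
by rewrite padic_abs_distC leNgt h.
Qed.
End PadicAbs.

Section Qp.
Variables (R : realType) (p : nat) (pr : prime p).
Local Notation absp := (@padic_abs R p).

Definition padic_cauchy : pred (nat -> rat) := fun u =>
  `[< forall e : R, 0 < e -> exists N, forall m n, (N <= m)%N -> (N <= n)%N ->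
      absp (u m - u n) < e >].

Lemma padic_cauchyP u : padic_cauchy u <->
  forall e : R, 0 < e -> exists N, forall m n, (N <= m)%N -> (N <= n)%N ->
      absp (u m - u n) < e.
Proof. by split => [/asboolP//|h]; apply/asboolP. Qed.

Lemma padic_cauchy_bounded u : padic_cauchy u ->
  exists2 B : R, 0 < B & exists N, forall n, (N <= n)%N -> absp (u n) <= B.
Proof.
move=> /padic_cauchyP /(_ 1 ltr01)[N HN].
exists (Num.max 1 (absp (u N))); first by rewrite lt_max ltr01.
exists N => n Nn; rewrite -(subrK (u N) (u n)).
apply: le_trans (@padic_absD R p pr _ _) _; rewrite ge_max !le_max lexx orbT andbT.
by rewrite ltW // HN.
Qed.

Lemma padic_cauchy_subring : subring_closed padic_cauchy.
Proof.
split=> [|u v /padic_cauchyP hu /padic_cauchyP hv|u v hu hv];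
  apply/padic_cauchyP => e e0.
- by exists 0%N => m n _ _; rewrite subrr padic_abs0.
- have [N HN] := hu _ e0; have [M HM] := hv _ e0.
  exists (maxn N M) => m n; rewrite !geq_max => /andP[Nm Mm] /andP[Nn Mn].
  have -> : (u - v) m - (u - v) n = (u m - u n) - (v m - v n).
    rewrite !fctE; ring.
  apply: le_lt_trans (@padic_absD R p pr _ _) _.
  by rewrite padic_absN // gt_max HN // HM.
have [B B0 [NB HB]] := padic_cauchy_bounded hu.
have [C C0 [NC HC]] := padic_cauchy_bounded hv.
have [N HN] := (padic_cauchyP u).1 hu _ (divr_gt0 e0 C0).
have [M HM] := (padic_cauchyP v).1 hv _ (divr_gt0 e0 B0).
exists (maxn (maxn N M) (maxn NB NC)) => m n; rewrite !geq_max.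
move=> /andP[/andP[Nm Mm] /andP[Bm Cm]] /andP[/andP[Nn Mn] /andP[Bn Cn]].
have -> : (u * v) m - (u * v) n = (u m - u n) * v m + u n * (v m - v n).
  rewrite !fctE; ring.
apply: le_lt_trans (@padic_absD R p pr _ _) _.
rewrite !padic_absM // gt_max; apply/andP; split.
  apply: (@le_lt_trans _ _ (absp (u m - u n) * C)).
    by rewrite ler_wpM2l ?padic_abs_ge0 ?HC.
  by rewrite -ltr_pdivlMr // HN.
apply: (@le_lt_trans _ _ (B * absp (v m - v n))).
  by rewrite ler_wpM2r ?padic_abs_ge0 ?HB.
by rewrite mulrC -ltr_pdivlMr // HM.
Qed.

HB.instance Definition _ :=
  GRing.isSubringClosed.Build (nat -> rat) padic_cauchy padic_cauchy_subring.

Record cauchy_rat := CauchyRat {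
  cauchy_val :> nat -> rat; _ : cauchy_val \in padic_cauchy }.

HB.instance Definition _ := [isSub for cauchy_val].
HB.instance Definition _ := [Choice of cauchy_rat by <:].
HB.instance Definition _ := [SubChoice_isSubComNzRing of cauchy_rat by <:].

Lemma cauchy_val0 : cauchy_val 0 = 0. Proof. exact: (raddf0 \val). Qed.
Lemma cauchy_val1 : cauchy_val 1 = 1. Proof. exact: (rmorph1 \val). Qed.
Lemma cauchy_valD : {morph cauchy_val : u v / u + v}.
Proof. exact: (raddfD \val). Qed.
Lemma cauchy_valB : {morph cauchy_val : u v / u - v}.
Proof. exact: (raddfB \val). Qed.
Lemma cauchy_valN : {morph cauchy_val : u / - u}.
Proof. exact: (raddfN \val). Qed.
Lemma cauchy_valM : {morph cauchy_val : u v / u * v}.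
Proof. exact: (rmorphM \val). Qed.

Definition padic_null : {pred cauchy_rat} := fun u =>
  `[< forall e : R, 0 < e -> exists N, forall n, (N <= n)%N -> absp (u n) < e >].

Lemma padic_nullP u : padic_null u <->
  forall e : R, 0 < e -> exists N, forall n, (N <= n)%N -> absp (u n) < e.
Proof. by split => [/asboolP//|h]; apply/asboolP. Qed.

Lemma padic_null_ideal : idealr_closed padic_null.
Proof.
split=> [||a u v /padic_nullP hu /padic_nullP hv].
- apply/padic_nullP => e e0; exists 0%N => n _.
  by rewrite cauchy_val0 padic_abs0.
- apply/negP => /padic_nullP /(_ 1 ltr01)[N /(_ _ (leqnn _))].
  by rewrite cauchy_val1 padic_abs1 // ltxx.
have [B B0 [NB HB]] := padic_cauchy_bounded (valP a).
apply/padic_nullP => e e0.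
have [N HN] := hu _ (divr_gt0 e0 B0); have [M HM] := hv _ e0.
exists (maxn NB (maxn N M)) => n; rewrite !geq_max => /and3P[Bn Nn Mn].
have -> : (a * u + v) n = a n * u n + v n.
  by rewrite cauchy_valD cauchy_valM !fctE.
apply: le_lt_trans (@padic_absD R p pr _ _) _.
rewrite gt_max HM // andbT padic_absM // mulrC.
apply: (@le_lt_trans _ _ (absp (u n) * B)).
  by rewrite ler_wpM2l ?padic_abs_ge0 ?HB.
by rewrite -ltr_pdivlMr // HN.
Qed.

HB.instance Definition _ := isIdealr.Build cauchy_rat padic_null padic_null_ideal.

(* The completion of the rationals for the p-adic absolute value: Cauchy
   sequences modulo null sequences. The parameter R is only there as the type in
   which absolute values live. *)
Definition padic := {ideal_quot padic_null}.

HB.instance Definition _ := GRing.ComNzRing.on padic.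

Lemma padic_pi_eq0 (u : cauchy_rat) :
  (\pi_padic u == 0) = padic_null u.
Proof.
have -> : 0 = \pi_padic 0 by rewrite rmorph0.
by rewrite -Quotient.idealrBE subr0.
Qed.

Lemma padic_piD u v : \pi_padic (u + v) = \pi_padic u + \pi_padic v.
Proof. exact: rmorphD. Qed.

Lemma padic_piB u v : \pi_padic (u - v) = \pi_padic u - \pi_padic v.
Proof. exact: rmorphB. Qed.

Lemma cauchy_abs_eventually (u : cauchy_rat) : ~~ padic_null u ->
  exists2 c : R, 0 < c & exists N, forall n, (N <= n)%N -> absp (u n) = c.
Proof.
move=> /negP h.
have [e e0 He] : exists2 e : R, 0 < e & forall N, exists2 n, (N <= n)%N & e <= absp (u n).
  apply: contra_notP h => h; apply/padic_nullP => e e0.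
  apply: contra_notP h => h; exists e => // N.
  apply: contra_notP h => h; exists N => n Nn.
  by rewrite ltNge; apply/negP => en; apply: h; exists n.
have [N HN] := (padic_cauchyP u).1 (valP u) _ e0.
have [k Nk ek] := He N.
exists (absp (u k)); first exact: lt_le_trans ek.
exists N => n Nn; apply: padic_abs_eq => //.
exact: lt_le_trans (HN _ _ Nn Nk) ek.
Qed.

Lemma padic_has_inv (x : padic) : x != 0 -> exists y : padic, y * x = 1.
Proof.
elim/quotW: x => u; rewrite padic_pi_eq0 => /cauchy_abs_eventually[c c0 [N HN]].
have cv : (fun n => (u n)^-1) \in padic_cauchy.
  apply/padic_cauchyP => e e0.
  have [M HM] := (padic_cauchyP u).1 (valP u) _ (mulr_gt0 e0 (mulr_gt0 c0 c0)).
  exists (maxn N M) => m n; rewrite !geq_max => /andP[Nm Mm] /andP[Nn Mn].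
  have um : u m != 0 by rewrite -(@padic_abs_gt0 R p pr) HN.
  have un : u n != 0 by rewrite -(@padic_abs_gt0 R p pr) HN.
  have -> : (u m)^-1 - (u n)^-1 = (u n - u m) / (u m * u n).
    by field; rewrite um un.
  rewrite padic_absM // padic_absV // padic_absM // !HN //.
  by rewrite ltr_pdivrMr ?mulr_gt0 // HM.
exists (\pi_padic (CauchyRat cv)); apply/eqP; rewrite -rmorphM -subr_eq0.
rewrite -(rmorph1 \pi_padic) -rmorphB padic_pi_eq0; apply/padic_nullP => e e0.
exists N => n Nn.
rewrite cauchy_valB cauchy_valM cauchy_val1 !fctE /= mulVf ?subrr ?padic_abs0 //.
by rewrite -(@padic_abs_gt0 R p pr) HN.
Qed.

(* xget returns its default 0 when x = 0 has no inverse. *)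
Definition padic_inv (x : padic) : padic := xget 0 [set y | y * x = 1].

Lemma padic_mulVf (x : padic) : x != 0 -> padic_inv x * x = 1.
Proof. by move=> x0; exact: (xgetPex 0 (padic_has_inv x0)). Qed.

Lemma padic_inv0 : padic_inv 0 = 0.
Proof. by apply: xgetPN => y /eqP; rewrite mulr0 eq_sym oner_eq0. Qed.

HB.instance Definition _ :=
  GRing.ComNzRing_isField.Build padic padic_mulVf padic_inv0.

(* The value does not depend on the representative, see
   padic_norm_cvg. *)
Definition padic_norm (x : padic) : R :=
  lim (absp (repr x n) @[n --> \oo]).

Lemma cauchy_abs_cvg (u : cauchy_rat) : exists2 c : R,
  absp (u n) @[n --> \oo] --> c & (c == 0) = padic_null u.
Proof.
have [nu|nu] := boolP (padic_null u).
  exists 0; last by rewrite eqxx.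
  apply/cvgrPdist_lt => e e0; have [N HN] := (padic_nullP u).1 nu e e0.
  exists N => // n /= Nn; rewrite sub0r normrN ger0_norm ?padic_abs_ge0 //.
  exact: HN.
have [c c0 [N HN]] := cauchy_abs_eventually nu.
exists c; last by rewrite gt_eqF.
by apply: cvg_near_cst; exists N => // n /= Nn; rewrite HN.
Qed.

Lemma padic_norm_cvg (u : cauchy_rat) :
  absp (u n) @[n --> \oo] --> padic_norm (\pi_padic u).
Proof.
have [c uc c0] := cauchy_abs_cvg u.
suff vc : absp (repr (\pi_padic u) n) @[n --> \oo] --> c.
  by rewrite /padic_norm (cvg_lim (@Rhausdorff R) vc).
set v := repr _; have vu : \pi_padic v = \pi_padic u by exact: reprK.
have [nu|nu] := boolP (padic_null u).
  have nv : padic_null v by rewrite -padic_pi_eq0 vu padic_pi_eq0.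
  have [d vd d0] := cauchy_abs_cvg v.
  have -> : c = d by transitivity (0 : R); apply/eqP; rewrite ?c0 // eq_sym d0.
  exact: vd.
have cp : 0 < c.
  rewrite lt0r c0 nu /=; rewrite -(cvg_lim (@Rhausdorff R) uc).
  apply: limr_ge; first by apply/cvg_ex; exists c.
  by apply: nearW => n; exact: padic_abs_ge0.
have uv : padic_null (v - u).
  by rewrite -padic_pi_eq0 padic_piB vu subrr.
have [d d0 [N HN]] := cauchy_abs_eventually nu.
have [M HM] := (padic_nullP _).1 uv _ d0.
apply: cvg_trans uc; apply: near_eq_cvg; exists (maxn N M) => // n /=.
rewrite geq_max => /andP[Nn Mn]; apply/esym/padic_abs_eq => //.
by have := HM _ Mn; rewrite cauchy_valB !fctE HN.
Qed.

Lemma padic_norm_ge0 x : 0 <= padic_norm x.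
Proof.
elim/quotW: x => u; rewrite -(cvg_lim (@Rhausdorff R) (@padic_norm_cvg u)).
apply: limr_ge; first by apply/cvg_ex; exists (padic_norm (\pi_padic u)); exact: padic_norm_cvg.
by apply: nearW => n; exact: padic_abs_ge0.
Qed.

Lemma padic_norm_eq0 x : (padic_norm x == 0) = (x == 0).
Proof.
elim/quotW: x => u; rewrite padic_pi_eq0; have [c uc <-] := cauchy_abs_cvg u.
by rewrite (cvg_unique (@Rhausdorff R) uc (@padic_norm_cvg u)).
Qed.

Lemma padic_normM x y : padic_norm (x * y) = padic_norm x * padic_norm y.
Proof.
elim/quotW: x => u; elim/quotW: y => v; rewrite -rmorphM.
apply: (cvg_unique (@Rhausdorff R) (@padic_norm_cvg _)) => //.
apply: cvg_trans (cvgM (@padic_norm_cvg u) (@padic_norm_cvg v)); apply: near_eq_cvg; apply: nearW => n.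
by rewrite cauchy_valM /= padic_absM.
Qed.

Lemma padic_normN x : padic_norm (- x) = padic_norm x.
Proof.
elim/quotW: x => u; rewrite -rmorphN.
apply: (cvg_unique (@Rhausdorff R) (@padic_norm_cvg _)) => //.
apply: cvg_trans (@padic_norm_cvg u); apply: near_eq_cvg; apply: nearW => n.
by rewrite cauchy_valN /= padic_absN.
Qed.

Lemma padic_normD x y :
  padic_norm (x + y) <= Num.max (padic_norm x) (padic_norm y).
Proof.
elim/quotW: x => u; elim/quotW: y => v; rewrite -padic_piD.
rewrite leNgt gt_max; apply/negP => /andP[hu hv].
have h1 := cvgB (@padic_norm_cvg (u + v)) (@padic_norm_cvg u).
have h2 := cvgB (@padic_norm_cvg (u + v)) (@padic_norm_cvg v).
rewrite -subr_gt0 in hu; rewrite -subr_gt0 in hv.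
have g1 : \forall n \near \oo, 0 < absp ((u + v) n) - absp (u n).
  exact: (cvgr_gt _ (h1 _) _ hu).
have g2 : \forall n \near \oo, 0 < absp ((u + v) n) - absp (v n).
  exact: (cvgr_gt _ (h2 _) _ hv).
have [n [] /= ] := filter_ex (filterI g1 g2).
rewrite !subr_gt0 => k1 k2; have := @padic_absD R p pr (u n) (v n).
by rewrite leNgt gt_max -[u n + v n]/((cauchy_val u + cauchy_val v) n)
  -cauchy_valD k1 k2.
Qed.

Fact cst_padic_cauchy (r : rat) : cst r \in padic_cauchy.
Proof.
by apply/padic_cauchyP => e e0; exists 0%N => m n _ _; rewrite subrr padic_abs0.
Qed.

Definition padic_of_rat (r : rat) : padic := \pi_padic (CauchyRat (cst_padic_cauchy r)).

Lemma padic_of_rat_zmod : zmod_morphism padic_of_rat.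
Proof.
move=> r s; rewrite /padic_of_rat -padic_piB; congr (\pi_padic _).
by apply: val_inj; rewrite [RHS]cauchy_valB.
Qed.

Lemma padic_of_rat_monoid : monoid_morphism padic_of_rat.
Proof.
split=> [|r s].
  rewrite -(rmorph1 \pi_padic); congr (\pi_padic _).
  by apply: val_inj; rewrite [RHS]cauchy_val1.
rewrite /padic_of_rat -rmorphM; congr (\pi_padic _).
by apply: val_inj; rewrite [RHS]cauchy_valM.
Qed.

HB.instance Definition _ :=
  GRing.isZmodMorphism.Build rat padic padic_of_rat padic_of_rat_zmod.
HB.instance Definition _ :=
  GRing.isMonoidMorphism.Build rat padic padic_of_rat padic_of_rat_monoid.

Lemma padic_norm_rat (r : rat) : padic_norm (ratr r) = absp r.
Proof.
rewrite -(fmorph_eq_rat padic_of_rat).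
apply: (cvg_unique (@Rhausdorff R) (@padic_norm_cvg _)) => //.
exact: (cvg_cst (absp r)).
Qed.

Definition padic_dist (x y : padic) : R := padic_norm (x - y).

Fact padic_distxx x : padic_dist x x = 0.
Proof. by apply/eqP; rewrite padic_norm_eq0 subrr. Qed.

Fact padic_dist_positivity x y : padic_dist x y = 0 -> x = y.
Proof. by move=> /eqP; rewrite padic_norm_eq0 subr_eq0 => /eqP. Qed.

Fact padic_dist_sym x y : padic_dist x y = padic_dist y x.
Proof. by rewrite /padic_dist -padic_normN opprB. Qed.

Fact padic_dist_triangle y x z :
  padic_dist x z <= padic_dist x y + padic_dist y z.
Proof.
rewrite /padic_dist -(subrKA y x (- z)); apply: le_trans (padic_normD _ _) _.
by rewrite ge_max lerDl lerDr !padic_norm_ge0.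
Qed.

HB.instance Definition _ := @isMetric.Build R padic padic_dist
  padic_distxx padic_dist_positivity padic_dist_sym padic_dist_triangle.

HB.instance Definition _ := isPointed.Build padic 0.

(* A limit for the metric padic_dist; arbitrary where the series diverges. *)
Definition padic_exp (x : padic) : padic :=
  lim (series (fun n => x ^+ n / n`!%:R) @ \oo).
End Qp.

(* Main.v *)
(* Put a = theta - 1, S = \sum_j z_j and b = S + 1, so that the denominator
   theta + S is a + b. Every z_i is a root x of x (a + b)^2 = (a x + b)^2, that
   is, of (x - 1) (a^2 x - b^2) = 0. If a = 0 then 1 is the only root, and
   otherwise b^2 / a^2 is the only root that may differ from 1. *)

Require Import Defs.
From mathcomp Require Import all_boot all_order all_algebra.
From mathcomp Require Import all_classical all_reals all_analysis.

From mathcomp Require Import ring.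

Import Order.TTheory GRing.Theory Num.Theory.

Local Open Scope ring_scope.

(** The value [(b / a) ^+ 2] does not involve [x], so all coordinates different from 1 coincide once
    [a] and [b] are fixed. *)
Lemma potts_root (F : fieldType) (a b x : F) :
  a + b != 0 -> x = ((a * x + b) / (a + b)) ^+ 2 -> x != 1 ->
  x = (b / a) ^+ 2.
Proof.
move=> ab0 xE x1.
have x_root : x * (a + b) ^+ 2 = (a * x + b) ^+ 2.
  by rewrite {1}xE exprMn exprVn divfK ?expf_neq0.
have a2x : a ^+ 2 * x = b ^+ 2.
  apply/eqP; rewrite -subr_eq0; apply/eqP/(mulfI (x := x - 1)).
    by rewrite subr_eq0.
  rewrite mulr0; transitivity ((a * x + b) ^+ 2 - x * (a + b) ^+ 2); first ring.
  by rewrite x_root subrr.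
(* If [a = 0], then [a2x] forces [b = 0], against [ab0]. *)
have a0 : a != 0.
  apply: contra_neq ab0 => a0; move/esym/eqP: a2x.
  by rewrite a0 expr0n mul0r expf_eq0 add0r => /eqP.
by rewrite expr_div_n -a2x mulrC mulKf ?expf_neq0.
Qed.

Theorem theorem3 (R : realType) (p : nat) (pr : prime p) (q : nat)
  (q_ge2 : (2 <= q)%N) (J theta : padic R pr)
  (J_small : padic_norm J < p%:R `^ (- (p.-1%:R)^-1))
  (thetaE : theta = padic_exp J)
  (z : 'I_q.-1 -> padic R pr)
  (den_neq0 : theta + \sum_(j < q.-1) z j != 0)
  (z_sol : forall i : 'I_q.-1,
     z i = (((theta - 1) * z i + \sum_(j < q.-1) z j + 1)
            / (theta + \sum_(j < q.-1) z j)) ^+ 2) :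
  exists (M : {set 'I_q.-1}) (zstar : padic R pr),
    forall i : 'I_q.-1,
      (i \notin M -> z i = 1) /\ (i \in M -> z i = zstar).
Proof.
set S := \sum_(j < q.-1) z j in den_neq0 z_sol *.
(* When [theta = 1], division by zero makes the second witness 0; this is harmless, since every
   [z i] is then 1 and the set is empty. *)
exists [set i | z i != 1]%SET, (((S + 1) / (theta - 1)) ^+ 2) => i.
rewrite inE; split=> [|zi1]; first by rewrite negbK => /eqP.
have DE : theta - 1 + (S + 1) = theta + S by ring.
by apply: potts_root; rewrite ?DE // addrA.
Qed.
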